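(* Let $F:\mathbf M\to\mathbf C$ be a functor between small categories that is a category of models for $\mathbf C$. Let $\Sigma$ be the set of morphisms $\mathfrak f$ of $\mathbf M$ such that $F(\mathfrak f)$ is an isomorphism of $\mathbf C$, and let $\bar F:\mathbf M[\Sigma^{-1}]\to\mathbf C$ be the functor induced by $F$ on the localized category. Then $\bar F$ is an equivalence of categories.
   Context: All categories are small. Given a functor $F:\mathbf M\to\mathbf C$, an object $\mathfrak X$ of $\mathbf M$ with $F(\mathfrak X)=X$ is called a model of $X$, and a morphism $\mathfrak f$ of $\mathbf M$ is said to be over $F(\mathfrak f)$. The functor $F$ (or $\mathbf M$) is called a category of models for $\mathbf C$ if: (1) every object $X$ of $\mathbf C$ admits a model, i.e. $F$ is surjective on objects; (2) given a morphism $f:X\to Y$ in $\mathbf C$ and models $\mathfrak X$ of $X$ and $\mathfrak Y$ of $Y$, there is a model $\mathfrak X'$ of $X$ together with a morphism $\mathfrak X'\to\mathfrak X$ over $\mathrm{id}_X$ and a morphism $\mathfrak X'\to\mathfrak Y$ over $f$; (3) given a morphism $f:X\to Y$ in $\mathbf C$ and two morphisms $\mathfrak f_1,\mathfrak f_2:\mathfrak X\to\mathfrak Y$ over $f$, there are a model $\mathfrak X'$ of $X$, morphisms $\pi:\mathfrak X'\to\mathfrak X$ over $\mathrm{id}_X$ and $\mathfrak f':\mathfrak X'\to\mathfrak Y$ over $f$, and morphisms $\mathfrak g_i:\mathfrak X\to\mathfrak X'$ over $\mathrm{id}_X$ ($i=1,2$) such that $\pi\circ\mathfrak g_i=\mathrm{id}_{\mathfrak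 X}$ and $\mathfrak f'\circ\mathfrak g_i=\mathfrak f_i$ for $i=1,2$. $\mathbf M[\Sigma^{-1}]$ is the Gabriel–Zisman localization, with the same objects as $\mathbf M$ and the localization functor $p:\mathbf M\to\mathbf M[\Sigma^{-1}]$; $\bar F$ is the unique functor with $\bar F\circ p=F$. *)

(* Defs.v *)
From mathcomp Require Import all_boot.
From mathcomp Require Import generic_quotient boolp.

Set Implicit Arguments.
Unset Strict Implicit.
Unset Printing Implicit Defensive.

Declare Scope cat_scope.
Delimit Scope cat_scope with cat.
Local Open Scope cat_scope.
Local Open Scope quotient_scope.

(* Small categories; [ccomp g f] is "g after f". *)
Record category : Type := Category {
  ob :> Type;
  hom : ob -> ob -> Type;
  idm : forall X, hom X X;
  ccomp : forall X Y Z, hom Y Z -> hom X Y -> hom X Z;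
  ccomp1m : forall X Y (f : hom X Y), ccomp (idm Y) f = f;
  ccompm1 : forall X Y (f : hom X Y), ccomp f (idm X) = f;
  ccompA : forall X Y Z W (h : hom Z W) (g : hom Y Z) (f : hom X Y),
    ccomp h (ccomp g f) = ccomp (ccomp h g) f
}.
Arguments hom {c} X Y.
Arguments idm {c} X.
Arguments ccomp {c X Y Z} g f.
Notation "g '\o' f" := (ccomp g f) : cat_scope.

Definition is_iso (C : category) (X Y : C) (f : hom X Y) : Prop :=
  exists g : hom Y X, g \o f = idm X /\ f \o g = idm Y.

Record functor (C D : category) : Type := Functor {
  fob :> C -> D;
  fmap : forall X Y : C, hom X Y -> hom (fob X) (fob Y);
  fmap1 : forall X : C, fmap (idm X) = idm (fob X);
  fmapM : forall (X Y Z : C) (g : hom Y Z) (f : hom X Y),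
    fmap (g \o f) = fmap g \o fmap f
}.
Arguments fmap {C D} _ [X Y] _.

Program Definition functor_id (C : category) : functor C C :=
  @Functor C C (fun X => X) (fun X Y f => f) _ _.

Program Definition functor_comp (C D E : category)
    (G : functor D E) (F : functor C D) : functor C E :=
  @Functor C E (fun X => G (F X)) (fun X Y f => fmap G (fmap F f)) _ _.
Next Obligation. by rewrite !fmap1. Qed.
Next Obligation. by rewrite !fmapM. Qed.

Definition naturally_isomorphic (C D : category) (F G : functor C D) : Prop :=
  exists eta : forall X : C, hom (F X) (G X),
    (forall (X Y : C) (f : hom X Y), eta Y \o fmap F f = fmap G f \o eta X) /\
    (forall X : C, is_iso (eta X)).

Definition is_equivalence (C D : category) (F : functor C D) : Prop :=
  exists G : functor D C,
    naturally_isomorphic (functor_comp G F) (functor_id C) /\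
    naturally_isomorphic (functor_comp F G) (functor_id D).

(* [over F f m]: the morphism m of M lies over f, i.e. F(m) = f as arrows of C.
   An inductive family is used because the ends of f need only be propositionally
   equal to the images of the ends of m. *)
Variant over (M C : category) (F : functor M C) :
    forall X Y : C, hom X Y -> forall A B : M, hom A B -> Prop :=
  | Over (A B : M) (m : hom A B) : @over M C F (F A) (F B) (fmap F m) A B m.
Arguments over {M C} F {X Y} f {A B} m.

Definition models_exist (M C : category) (F : functor M C) : Prop :=
  forall X : C, exists A : M, F A = X.

Definition models_lift (M C : category) (F : functor M C) : Prop :=
  forall (X Y : C) (f : hom X Y) (A B : M), F A = X -> F B = Y ->
  exists (A' : M) (p : hom A' A) (q : hom A' B),
    [/\ F A' = X, over F (idm X) p & over F f q].

Definition models_cylinder (M C : category) (F : functor M C) : Prop :=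
  forall (X Y : C) (f : hom X Y) (A B : M) (f1 f2 : hom A B),
  over F f f1 -> over F f f2 ->
  exists (A' : M) (p : hom A' A) (f' : hom A' B) (g1 g2 : hom A A'),
    [/\ F A' = X,
        over F (idm X) p /\ over F f f',
        over F (idm X) g1 /\ over F (idm X) g2,
        p \o g1 = idm A /\ p \o g2 = idm A &
        f' \o g1 = f1 /\ f' \o g2 = f2].

Definition category_of_models (M C : category) (F : functor M C) : Prop :=
  [/\ models_exist F, models_lift F & models_cylinder F].

Definition morphism_class (M : category) : Type :=
  forall A B : M, hom A B -> Prop.

Definition inverted_by (M C : category) (F : functor M C) : morphism_class M :=
  fun A B m => is_iso (fmap F m).

(* Gabriel-Zisman localization: the objects of M, and as morphisms the finite
   paths made of arrows of M and formal inverses of arrows of S, modulo the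
   congruence generated by the composition of M and by s s^-1 = 1, s^-1 s = 1.
   Paths are listed in diagrammatic order. *)
Section Localization.
Variables (M : category) (S : morphism_class M).

Inductive zigzag : M -> M -> Type :=
  | zz_nil A : zigzag A A
  | zz_fwd A B D (f : hom A B) (w : zigzag B D) : zigzag A D
  | zz_bwd A B D (s : hom B A) (Ss : S s) (w : zigzag B D) : zigzag A D.

Fixpoint zz_cat A B D (w : zigzag A B) : zigzag B D -> zigzag A D :=
  match w in zigzag A B return zigzag B D -> zigzag A D with
  | zz_nil _ => fun v => v
  | zz_fwd _ _ _ f w => fun v => zz_fwd f (zz_cat w v)
  | zz_bwd _ _ _ s Ss w => fun v => zz_bwd Ss (zz_cat w v)
  end.

Inductive zz_eq : forall A B, zigzag A B -> zigzag A B -> Prop :=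
  | zz_eq_refl A B (w : zigzag A B) : zz_eq w w
  | zz_eq_sym A B (w v : zigzag A B) : zz_eq w v -> zz_eq v w
  | zz_eq_trans A B (w v u : zigzag A B) : zz_eq w v -> zz_eq v u -> zz_eq w u
  | zz_eq_cat A B D (w w' : zigzag A B) (v v' : zigzag B D) :
      zz_eq w w' -> zz_eq v v' -> zz_eq (zz_cat w v) (zz_cat w' v')
  | zz_eq_id A : zz_eq (zz_fwd (idm A) (zz_nil A)) (zz_nil A)
  | zz_eq_comp A B D (f : hom A B) (g : hom B D) :
      zz_eq (zz_fwd f (zz_fwd g (zz_nil D))) (zz_fwd (g \o f) (zz_nil D))
  | zz_eq_fwd_bwd A B (s : hom A B) (Ss : S s) :
      zz_eq (zz_fwd s (zz_bwd Ss (zz_nil A))) (zz_nil A)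
  | zz_eq_bwd_fwd A B (s : hom A B) (Ss : S s) :
      zz_eq (zz_bwd Ss (zz_fwd s (zz_nil B))) (zz_nil B).

Lemma zz_cats0 A B (w : zigzag A B) : zz_cat w (zz_nil B) = w.
Proof. by elim: w => //= [A1 B1 D1 f w IH|A1 B1 D1 s Ss w IH]; rewrite IH. Qed.

Lemma zz_catA A B D E (w : zigzag A B) (v : zigzag B D) (u : zigzag D E) :
  zz_cat w (zz_cat v u) = zz_cat (zz_cat w v) u.
Proof.
elim: w v => //= [A' B' D' f w IH|A' B' D' s Ss w IH] v; by rewrite IH.
Qed.

Definition zz_eqb A B : rel {classic zigzag A B} := fun w v => `[< zz_eq w v >].

Lemma zz_eqb_refl A B : reflexive (@zz_eqb A B).
Proof. by move=> w; apply/asboolP/zz_eq_refl. Qed.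

Lemma zz_eqb_sym A B : symmetric (@zz_eqb A B).
Proof. by move=> w v; apply/asboolP/asboolP; apply: zz_eq_sym. Qed.

Lemma zz_eqb_trans A B : transitive (@zz_eqb A B).
Proof.
by move=> v w u /asboolP wv /asboolP vu; apply/asboolP/(zz_eq_trans wv vu).
Qed.

Canonical zz_equiv A B :=
  EquivRel (@zz_eqb A B) (@zz_eqb_refl A B) (@zz_eqb_sym A B) (@zz_eqb_trans A B).

Definition loc_hom (A B : M) : Type := {eq_quot (zz_equiv A B)}.

Definition loc_class A B (w : zigzag A B) : loc_hom A B :=
  \pi_({eq_quot (zz_equiv A B)}) w.

Definition loc_repr A B (x : loc_hom A B) : zigzag A B :=
  repr (x : {eq_quot (zz_equiv A B)}).

Lemma loc_reprK A B (x : loc_hom A B) : loc_class (loc_repr x) = x.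
Proof. exact: reprK. Qed.

Lemma loc_classP A B (w v : zigzag A B) :
  loc_class w = loc_class v <-> zz_eq w v.
Proof.
split=> [e|e]; last by apply/eqmodP/asboolP.
by apply/asboolP; move/eqmodP: e.
Qed.

Lemma loc_repr_class A B (w : zigzag A B) : zz_eq (loc_repr (loc_class w)) w.
Proof. by apply/loc_classP; rewrite loc_reprK. Qed.

Definition loc_id (A : M) : loc_hom A A := loc_class (zz_nil A).

Definition loc_comp (A B D : M) (y : loc_hom B D) (x : loc_hom A B) :
  loc_hom A D := loc_class (zz_cat (loc_repr x) (loc_repr y)).

Lemma loc_compE A B D (v : zigzag B D) (w : zigzag A B) :
  loc_comp (loc_class v) (loc_class w) = loc_class (zz_cat w v).
Proof. by apply/loc_classP; apply: zz_eq_cat; apply: loc_repr_class. Qed.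

Lemma loc_comp1m A B (x : loc_hom A B) : loc_comp (loc_id B) x = x.
Proof. by rewrite -(loc_reprK x) loc_compE zz_cats0. Qed.

Lemma loc_compm1 A B (x : loc_hom A B) : loc_comp x (loc_id A) = x.
Proof. by rewrite -(loc_reprK x) loc_compE. Qed.

Lemma loc_compA A B D E (z : loc_hom D E) (y : loc_hom B D) (x : loc_hom A B) :
  loc_comp z (loc_comp y x) = loc_comp (loc_comp z y) x.
Proof.
by rewrite -(loc_reprK x) -(loc_reprK y) -(loc_reprK z) !loc_compE zz_catA.
Qed.

Definition localization : category :=
  @Category M loc_hom loc_id loc_comp loc_comp1m loc_compm1 loc_compA.

Definition loc_arrow (A B : M) (f : hom A B) : loc_hom A B :=
  loc_class (zz_fwd f (zz_nil B)).

Lemma loc_arrow1 (A : M) : loc_arrow (idm A) = loc_id A.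
Proof. exact/loc_classP/zz_eq_id. Qed.

Lemma loc_arrowM (A B D : M) (g : hom B D) (f : hom A B) :
  loc_arrow (g \o f) = loc_comp (loc_arrow g) (loc_arrow f).
Proof. by rewrite loc_compE; apply/loc_classP/zz_eq_sym/zz_eq_comp. Qed.

Definition loc_functor : functor M localization :=
  @Functor M localization (fun A => A) loc_arrow loc_arrow1 loc_arrowM.

Lemma loc_functor_inverts (A B : M) (s : hom A B) :
  S s -> is_iso (fmap loc_functor s).
Proof.
move=> Ss; exists (loc_class (zz_bwd Ss (zz_nil A))).
by split; rewrite /= loc_compE; apply/loc_classP;
  [apply: zz_eq_fwd_bwd | apply: zz_eq_bwd_fwd].
Qed.

Variables (C : category) (F : functor M C).
Hypothesis FS : forall (A B : M) (s : hom A B), S s -> is_iso (fmap F s).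

Definition iso_inv (X Y : C) (f : hom X Y) (fi : is_iso f) : hom Y X :=
  projT1 (cid fi).

Lemma iso_invl (X Y : C) (f : hom X Y) (fi : is_iso f) : iso_inv fi \o f = idm X.
Proof. by rewrite /iso_inv; case: (cid fi) => g []. Qed.

Lemma iso_invr (X Y : C) (f : hom X Y) (fi : is_iso f) : f \o iso_inv fi = idm Y.
Proof. by rewrite /iso_inv; case: (cid fi) => g []. Qed.

Fixpoint zz_eval (A B : M) (w : zigzag A B) : hom (F A) (F B) :=
  match w in zigzag A B return hom (F A) (F B) with
  | zz_nil A => idm (F A)
  | zz_fwd _ _ _ f w => zz_eval w \o fmap F f
  | zz_bwd _ _ _ s Ss w => zz_eval w \o iso_inv (FS Ss)
  end.

Lemma zz_eval_cat A B D (w : zigzag A B) (v : zigzag B D) :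
  zz_eval (zz_cat w v) = zz_eval v \o zz_eval w.
Proof.
by elim: w v => [A'|A' B' D' f w IH|A' B' D' s Ss w IH] v /=;
  rewrite ?ccompm1 // IH ccompA.
Qed.

Lemma zz_eval_eq A B (w v : zigzag A B) : zz_eq w v -> zz_eval w = zz_eval v.
Proof.
elim=> //= {A B w v}.
- by move=> A B w v u _ -> _ ->.
- by move=> A B D w w' v v' _ e1 _ e2; rewrite !zz_eval_cat e1 e2.
- by move=> A; rewrite ccomp1m fmap1.
- by move=> A B D f g; rewrite !ccomp1m fmapM.
- by move=> A B s Ss; rewrite ccomp1m iso_invl.
- by move=> A B s Ss; rewrite ccomp1m iso_invr.
Qed.

Definition loc_eval (A B : M) (x : loc_hom A B) : hom (F A) (F B) :=
  zz_eval (loc_repr x).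

Lemma loc_evalE A B (w : zigzag A B) : loc_eval (loc_class w) = zz_eval w.
Proof. exact/zz_eval_eq/loc_repr_class. Qed.

Lemma loc_eval1 (A : M) : loc_eval (loc_id A) = idm (F A).
Proof. by rewrite loc_evalE. Qed.

Lemma loc_evalM (A B D : M) (y : loc_hom B D) (x : loc_hom A B) :
  loc_eval (loc_comp y x) = loc_eval y \o loc_eval x.
Proof. by rewrite loc_evalE zz_eval_cat. Qed.

Definition loc_lift : functor localization C :=
  @Functor localization C (fun A => F A) loc_eval loc_eval1 loc_evalM.

End Localization.

Lemma functor_eqP (C D : category) (o : C -> D)
    (m m' : forall X Y : C, hom X Y -> hom (o X) (o Y)) h1 hM h1' hM' :
  (forall X Y (f : hom X Y), m X Y f = m' X Y f) ->
  @Functor C D o m h1 hM = @Functor C D o m' h1' hM'.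
Proof.
move=> e; have E : m = m'.
  by apply: functional_extensionality_dep => X;
     apply: functional_extensionality_dep => Y;
     apply: functional_extensionality_dep => f.
by case: m' / E {e} h1' hM' => h1' hM'; congr Functor; apply: Prop_irrelevance.
Qed.

Lemma loc_lift_comp (M : category) (S : morphism_class M) (C : category)
    (F : functor M C) FS : functor_comp (@loc_lift M S C F FS) (loc_functor S) = F.
Proof.
case: F FS => o m h1 hM FS; apply: functor_eqP => X Y f /=.
by rewrite loc_evalE /= ccomp1m.
Qed.

Lemma loc_lift_unique (M : category) (S : morphism_class M) (C : category)
    (F : functor M C) FS (G : functor (localization S) C) :
  functor_comp G (loc_functor S) = F -> G = @loc_lift M S C F FS.
Proof.
move=> E; case: F / E FS; case: G => o m h1 hM FS.
apply: functor_eqP => X Y x /=; rewrite -(loc_reprK x) loc_evalE.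
elim: (loc_repr x) => {X Y x} [A|A B D f w IH|A B D s Ss w IH] /=.
- exact: h1.
- have -> : loc_class (zz_fwd f w) = loc_comp (loc_class w) (loc_arrow S f).
    by rewrite loc_compE.
  by rewrite (hM A B D) IH.
have -> : loc_class (zz_bwd Ss w)
    = loc_comp (loc_class w) (loc_class (zz_bwd Ss (zz_nil S B))).
  by rewrite loc_compE.
rewrite (hM A B D) IH; congr (_ \o _).
set i := iso_inv _; set b := m _ _ _.
have bs : m _ _ (loc_arrow S s) \o b = idm (o A).
  rewrite -(hM A B A) -h1 /= loc_compE; congr m.
  exact/loc_classP/zz_eq_bwd_fwd.
have := iso_invl (FS _ _ _ Ss); rewrite -/i /= => is1.
by rewrite -[b]ccomp1m -is1 -ccompA bs ccompm1.
Qed.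

(* By [loc_lift_comp] and [loc_lift_unique], the unique functor whose composite
   with [loc_functor] is F. *)
Definition induced_functor (M C : category) (F : functor M C) :
    functor (localization (inverted_by F)) C :=
  @loc_lift M (inverted_by F) C F (fun A B s Ss => Ss).

(* Main.v *)
From mathcomp Require Import all_boot boolp.
Require Import Defs.

Set Implicit Arguments.
Unset Strict Implicit.
Unset Printing Implicit Defensive.

Local Open Scope cat_scope.

(** The induced functor is surjective on objects because models exist, so it
    has to be shown full and faithful.

    Write [m] for the image of a morphism m of M in the localization.  A map
    h : F A -> F B lifts to a span p : A' -> A, q : A' -> B with p over an
    identity and q over h; since [p] is invertible, the fraction [q][p]^-1 is
    a preimage of h, hence fullness (induced_functor_full).

    For faithfulness, a cylinder identifies parallel maps of M with the same
    image in C: both sections g1, g2 of its projection p become the inverse of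
    [p], so [f1] = [f' g1] = [f' g2] = [f2] (eq_fmap_loc).  More generally
    (zigzag_recognition), if q : A' -> B and p : A' -> A are maps of M and w
    is a zigzag from A to B such that F(q) = F(w) F(p), then [q] = [w][p].
    Two morphisms of the localization with the same image h in C are then
    both equal to [q][p]^-1, for one and the same span (p, q) lifting h. *)

Lemma iso_epi (C : category) (X Y Z : C) (s : hom X Y) (f g : hom Y Z) :
  is_iso s -> f \o s = g \o s -> f = g.
Proof.
by move=> [t [_ st]] e; rewrite -(ccompm1 f) -(ccompm1 g) -st !ccompA e.
Qed.

Lemma iso_mono (C : category) (X Y Z : C) (s : hom Y Z) (f g : hom X Y) :
  is_iso s -> s \o f = s \o g -> f = g.
Proof.
by move=> [t [ts _]] e; rewrite -(ccomp1m f) -(ccomp1m g) -ts -!ccompA e.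
Qed.

Section FullyFaithful.
Variables (C D : category) (F : functor C D).

Definition full : Prop :=
  forall (A B : C) (h : hom (F A) (F B)), exists f : hom A B, fmap F f = h.

Definition faithful : Prop :=
  forall (A B : C) (f g : hom A B), fmap F f = fmap F g -> f = g.

Definition essentially_surjective : Prop :=
  forall X : D, exists (A : C) (e : hom (F A) X), is_iso e.

Lemma full_faithful_reflects_iso (A B : C) (f : hom A B) :
  full -> faithful -> is_iso (fmap F f) -> is_iso f.
Proof.
move=> Ffull Ffaith [h [hf fh]]; case: (Ffull _ _ h) => g gh.
by exists g; split; apply: Ffaith; rewrite fmapM gh fmap1.
Qed.

(** The quasi-inverse sends X to a chosen A with an isomorphism
    e_X : F A -> X, and f to the morphism over the conjugate of f by these
    isomorphisms; faithfulness makes it a functor and e natural. *)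
Lemma equivalence_of_full_faithful :
  full -> faithful -> essentially_surjective -> is_equivalence F.
Proof.
move=> Ffull Ffaith Fsurj.
pose G0 X : C := projT1 (cid (Fsurj X)).
pose e X : hom (F (G0 X)) X := projT1 (cid (projT2 (cid (Fsurj X)))).
have eiso X : is_iso (e X) := projT2 (cid (projT2 (cid (Fsurj X)))).
pose e' X : hom X (F (G0 X)) := iso_inv (eiso X).
pose lift A B (h : hom (F A) (F B)) : hom A B := projT1 (cid (Ffull A B h)).
have liftK A B (h : hom (F A) (F B)) : fmap F (lift A B h) = h.
  exact: projT2 (cid (Ffull A B h)).
pose G1 X Y (f : hom X Y) : hom (G0 X) (G0 Y) := lift _ _ (e' Y \o (f \o e X)).
have enat X Y (f : hom X Y) : e Y \o fmap F (G1 X Y f) = f \o e X.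
  by rewrite liftK ccompA iso_invr ccomp1m.
have G1id X : G1 X X (idm X) = idm (G0 X).
  by apply/Ffaith/(iso_mono (eiso X)); rewrite enat fmap1 ccomp1m ccompm1.
have G1comp X Y Z (g : hom Y Z) (f : hom X Y) :
    G1 X Z (g \o f) = G1 Y Z g \o G1 X Y f.
  apply/Ffaith/(iso_mono (eiso Z)).
  by rewrite enat fmapM ccompA enat -!ccompA enat.
exists (@Functor D C G0 G1 G1id G1comp); split.
  exists (fun A => lift _ _ (e (F A))); split=> [A B f|A] /=.
    by apply: Ffaith; rewrite !fmapM !liftK ccompA iso_invr ccomp1m.
  by apply: full_faithful_reflects_iso; rewrite ?liftK.
by exists e; split.
Qed.

End FullyFaithful.

(** The model axioms only provide propositional equalities F A' = X between
    objects; such an equality is used through the isomorphism it induces. *)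
Definition eq_hom (C : category) (X Y : C) (e : X = Y) : hom X Y :=
  match e in _ = Z return hom X Z with erefl => idm X end.

Lemma eq_hom_iso (C : category) (X Y : C) (e : X = Y) : is_iso (eq_hom e).
Proof. by case: Y / e; exists (idm X); rewrite ccomp1m. Qed.

(** Since equality proofs between objects are irrelevant, being over f amounts
    to a commutative square with the induced isomorphisms, whichever proofs are
    used to form them. *)
Lemma over_square (M C : category) (F : functor M C) (X Y : C) (f : hom X Y)
    (A B : M) (m : hom A B) (eX : F A = X) (eY : F B = Y) :
  over F f m -> f \o eq_hom eX = eq_hom eY \o fmap F m.
Proof.
move=> o; case: X Y f A B m / o eX eY => A B m eX eY.
by rewrite (Prop_irrelevance eX erefl) (Prop_irrelevance eY erefl)
  ccomp1m ccompm1.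
Qed.

Lemma over_id (M C : category) (F : functor M C) (A A' : M) (p : hom A' A)
    (e : F A' = F A) :
  over F (idm (F A)) p -> fmap F p = eq_hom e.
Proof. by move=> /(over_square e erefl); rewrite !ccomp1m. Qed.

Section Models.
Variables (M C : category) (F : functor M C).

(** The condition that p lies over an identity is weakened to F(p) being
    invertible, all that forming the fraction of q by p requires; this keeps
    equalities between objects out of the later arguments. *)
Lemma models_span (A B : M) (h : hom (F A) (F B)) : models_lift F ->
  exists (A' : M) (p : hom A' A) (q : hom A' B),
    inverted_by F p /\ fmap F q = h \o fmap F p.
Proof.
move=> lift; case: (lift _ _ h A B erefl erefl) => A' [p [q [e po qo]]].
exists A', p, q; rewrite /inverted_by (over_id e po).
by split; [exact: eq_hom_iso | rewrite (over_square e erefl qo) ccomp1m].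
Qed.

Local Notation L := (loc_functor (inverted_by F)).

(** In a cylinder both sections of the projection become its inverse, hence
    become equal. *)
Lemma eq_fmap_loc (A B : M) (f1 f2 : hom A B) : models_cylinder F ->
  fmap F f1 = fmap F f2 -> fmap L f1 = fmap L f2.
Proof.
move=> cyl e12; have o2 : over F (fmap F f1) f2 by rewrite e12.
case: (cyl _ _ _ _ _ _ _ (Over F f1) o2).
move=> A' [p [f' [g1 [g2 [e [po _] _ [pg1 pg2] [<- <-]]]]]].
have piso : is_iso (fmap L p).
  by apply: loc_functor_inverts; rewrite /inverted_by (over_id e po);
    exact: eq_hom_iso.
rewrite !fmapM; congr (_ \o _); apply: (iso_mono piso).
by rewrite -!fmapM pg1 pg2.
Qed.

Local Notation evalF := (zz_eval (fun A B s Ss => Ss)).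

Lemma loc_class_fwd (A B D : M) (f : hom A B) (w : zigzag (inverted_by F) B D) :
  loc_class (zz_fwd f w) = (loc_class w : hom (B : localization _) D) \o fmap L f.
Proof. by rewrite /= loc_compE. Qed.

Lemma loc_class_bwd (A B D : M) (s : hom B A) (Ss : inverted_by F s)
    (w : zigzag (inverted_by F) B D) :
  (loc_class (zz_bwd Ss w) : hom (A : localization _) D) \o fmap L s = loc_class w.
Proof.
rewrite /= loc_compE; apply/loc_classP.
exact: (zz_eq_cat (zz_eq_fwd_bwd Ss) (zz_eq_refl w)).
Qed.

(** Induction on w, with p arbitrary.  A forward step f is absorbed by replacing
    p with f p.  For a backward step s, the map F(s)^-1 F(p) is lifted to a span
    (r, t); then [s t] = [p r] as these have the same image in C, the induction
    hypothesis applies to t and q r, and [r] is cancelled. *)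
Lemma zigzag_recognition (A B : M) (w : zigzag (inverted_by F) A B)
    (A' : M) (p : hom A' A) (q : hom A' B) :
  models_lift F -> models_cylinder F ->
  fmap F q = evalF w \o fmap F p ->
  fmap L q = (loc_class w : hom (A : localization _) B) \o fmap L p.
Proof.
move=> lift cyl.
elim: w A' p q => {A B} [A|A B D f w IH|A B D s Ss w IH] A' p q /=.
- rewrite ccomp1m => /(eq_fmap_loc cyl) /= ->.
  by rewrite -[LHS]loc_comp1m.
- rewrite -ccompA -fmapM => /IH /= ->.
  by rewrite [loc_class (zz_fwd _ _)]loc_class_fwd /= -loc_compA loc_arrowM.
move=> qE.
case: (models_span (iso_inv Ss \o fmap F p) lift) => [A'' [r [t [riso tE]]]].
have stE : fmap L (s \o t) = fmap L (p \o r).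
  by apply: eq_fmap_loc => //; rewrite !fmapM tE !ccompA iso_invr ccomp1m.
have qrE := IH A'' t (q \o r).
apply: (iso_epi (loc_functor_inverts riso)).
rewrite -[LHS]fmapM qrE; last by rewrite fmapM qE tE !ccompA.
by rewrite -(loc_class_bwd Ss) -!ccompA -!fmapM stE.
Qed.

Lemma induced_functor_full : models_lift F -> full (induced_functor F).
Proof.
move=> lift A B h; case: (models_span (A := A) (B := B) h lift).
move=> A' [p [q [piso qE]]].
exists (loc_class (zz_bwd piso (zz_fwd q (@zz_nil M _ B)))).
by rewrite /= loc_evalE /= ccomp1m qE -ccompA iso_invr ccompm1.
Qed.

Lemma induced_functor_faithful :
  models_lift F -> models_cylinder F -> faithful (induced_functor F).
Proof.
move=> lift cyl A B x y.
rewrite -(loc_reprK x) -(loc_reprK y) /= !loc_evalE => xy.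
case: (models_span (evalF (loc_repr x)) lift) => A' [p [q [piso qE]]].
have xq := zigzag_recognition lift cyl qE.
rewrite xy in qE; have yq := zigzag_recognition lift cyl qE.
by apply: (iso_epi (loc_functor_inverts piso)); rewrite -xq -yq.
Qed.

End Models.

Theorem theorem4p1p4 (M C : category) (F : functor M C)
  (HF : category_of_models F) :
  is_equivalence (induced_functor F).
Proof.
case: HF => models lift cyl; apply: equivalence_of_full_faithful.
- exact: induced_functor_full.
- exact: induced_functor_faithful.
- by move=> X; case: (models X) => A e; exists A, (eq_hom e); exact: eq_hom_iso.
Qed.
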